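(* The discrete logarithm problem in periodic semigroups reduces, in probabilistic polynomial time, to the classic discrete logarithm problem in a subgroup of the same semigroup. Precisely: let $S$ be a periodic semigroup, let $g\in S$, let $l,n\ge 1$ be minimal with $g^{l+n}=g^l$, and let $G=\{g^{l+k} : 0\le k<n\}$, which is a cyclic subgroup of $S$. There is a probabilistic algorithm, the same for all such $S$ and $g$, that, given $g$ and a power $h=g^x$ of $g$ (but not $x$, $l$, $n$ or the order of $g$), and given access to the multiplication of $S$ and to a DLP oracle for $G$, computes with high probability (say, at least $2/3$) a natural number $k\ge 1$ such that $g^k=h$. Its running time, each oracle call being counted as one step, is polynomial in the relevant parameters $\kappa(g)$.
   Context: $\mathbb{N}$ is the set of positive integers. The order of an element $g$ of a semigroup $S$ is the cardinality of $\{g^k : k\in\mathbb{N}\}$; $S$ is periodic (torsion) if every element has finite order. The DLP in a periodic semigroup $S$ is: given $g\in S$ and a power $h$ of $g$, find a natural number $k$ with $g^k=h$. Minimality of $l,n$: $l,n$ are positive integers with $g^{l+n}=g^l$, each as small as possible; it does not matter whether one first minimizes $l$ and then $n$ or vice versa. By ''subgroup of $S$'' is meant a subsemigroup of $S$ that is a group under the multiplication of $S$ (its neutral element need not be neutral for $S$). Computational model: each semigroup element has a unique representation as a bitstring (or a canonical representative computable in polynomial time). Let $\kappa(g)$ be the sum of the maximal bitlength of the representations of the powers of $g$ and $\log_2$ of the order of $g$. Multiplication of powers of $g$ can be carried out in time polynomial in $\kappa(g)$ (with a fixed polynomial). A DLP oracle for a finite cyclic group $G$ is an oracle that, whenever provided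 with a generator $r$ of $G$ and a power $u$ of $r$, returns a natural number $k$, of bit size polynomial in the relevant parameters, such that $u=r^k$. The oracle is not provided with $G$ directly, but via its generator and the definition of multiplication in the group. Repeated calls with the same input may return different values of $k$. *)

(* Defs.v *)
From mathcomp Require Import all_boot all_order all_algebra.
From mathcomp Require Import finmap.
From mathcomp Require Import boolp classical_sets cardinality reals exp.

Set Implicit Arguments.
Unset Strict Implicit.
Unset Printing Implicit Defensive.

Import Order.TTheory GRing.Theory Num.Theory.

Local Open Scope ring_scope.
Local Open Scope classical_set_scope.

Section Semigroups.
Variable S : semigroupType.
Implicit Types (g r a b e : S) (G : set S).

(* g^k for k >= 1; a semigroup has no g^0, and the value at k = 0 is junk
   (it is g), so every use below comes with k > 0. *)
Definition spow g k : S := iter k.-1 (fun a => (a * g)%g) g.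

Definition powers g : set S := [set a | exists2 k, (0 < k)%N & a = spow g k].

Definition periodic : Prop := forall g, finite_set (powers g).

Definition sorder g : nat := #|` fset_set (powers g)|%fset.

(* l and n are positive, g^(l+n) = g^l, and each is minimal among all pairs
   with this property (so the order of minimization is irrelevant). *)
Definition minimal_index_period g (l n : nat) : Prop :=
  [/\ (0 < l)%N, (0 < n)%N, spow g (l + n) = spow g l
    & forall l' n', (0 < l')%N -> (0 < n')%N ->
        spow g (l' + n') = spow g l' -> (l <= l')%N /\ (n <= n')%N].

Definition periodic_part g (l n : nat) : set S :=
  [set a | exists2 k, (k < n)%N & a = spow g (l + k)].

(* The neutral element of G need not be neutral for S. *)
Definition subgroup G : Prop :=
  (forall a b, G a -> G b -> G (a * b)%g) /\
  exists e, [/\ G e, (forall a, G a -> (e * a)%g = a /\ (a * e)%g = a)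
    & forall a, G a -> exists b, [/\ G b, (a * b)%g = e & (b * a)%g = e]].

(* Positive powers suffice: only finite groups G are considered. *)
Definition generates r G : Prop := powers r = G.

Definition cyclic_subgroup G : Prop :=
  subgroup G /\ exists r, generates r G.

End Semigroups.

Definition kappa (R : realType) (S : semigroupType) (rep : S -> bitseq)
    (g : S) : R :=
  (\max_(a <- fset_set (powers g)) size (rep a))%N%:R
  + ln (sorder g)%:R / ln 2.

(* Number of binary digits, with bitlen 0 = 0. *)
Definition bitlen (k : nat) : nat := up_log 2 k.+1.

(* Probabilistic oracle algorithms are WHILE programs over finitely many
   registers holding natural numbers or bitstrings, charged the bit size of
   their operands (logarithmic cost).  Two numeric registers under doubling,
   halving and parity tests simulate a Turing tape, and conversely each
   instruction is executed by a multitape Turing machine in time polynomial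
   in its charge, so this is probabilistic Turing time up to a polynomial. *)
Inductive op :=
| NConst (x k : nat)
| NAdd (x y z : nat)
| NSub (x y z : nat)
| NMul (x y z : nat)
| NHalf (x y : nat)
| NFlip (x : nat)
| SSize (x u : nat)
| SCopy (u v : nat)
| SMul (u v w : nat)
| DLog (x u v : nat).

Inductive test :=
| NLt (x y : nat)
| NOdd (x : nat)
| SEq (u v : nat).

Inductive cmd :=
| Op (o : op)
| Seq (c1 c2 : cmd)
| If (b : test) (c1 c2 : cmd)
| While (b : test) (c : cmd).

(* [coins] are the coin flips not yet consumed and [asked] the past inputs to
   the DLP oracle, latest first. *)
Record state := State {
  nreg : nat -> nat;
  sreg : nat -> bitseq;
  coins : seq bool;
  asked : seq (bitseq * bitseq)
}.

(* [mul] multiplies representations and [mulcost] is the time this takes.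
   The answer of [dlog] may depend on the inputs of all earlier calls, so that
   equal inputs may be answered differently, but it cannot depend on the coins
   other than through these inputs.  A randomized oracle is a random choice of
   such a [dlog], independent of the coins. *)
Record oracles := Oracles {
  mul : bitseq -> bitseq -> bitseq;
  mulcost : bitseq -> bitseq -> nat;
  dlog : seq (bitseq * bitseq) -> bitseq -> bitseq -> nat
}.

Definition upd (T : Type) (f : nat -> T) (x : nat) (a : T) : nat -> T :=
  fun y => if y == x then a else f y.

Definition nset (s : state) (x k : nat) : state :=
  State (upd (nreg s) x k) (sreg s) (coins s) (asked s).

Definition sset (s : state) (u : nat) (w : bitseq) : state :=
  State (nreg s) (upd (sreg s) u w) (coins s) (asked s).

Section Semantics.
Variable O : oracles.

(* The new state and the cost; None if a coin is needed and none is left. *)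
Definition op_step (o : op) (s : state) : option (state * nat) :=
  match o with
  | NConst x k => Some (nset s x k, (1 + bitlen k)%N)
  | NAdd x y z =>
      Some (nset s x (nreg s y + nreg s z)%N,
            (1 + bitlen (nreg s y) + bitlen (nreg s z))%N)
  | NSub x y z =>
      Some (nset s x (nreg s y - nreg s z)%N,
            (1 + bitlen (nreg s y) + bitlen (nreg s z))%N)
  | NMul x y z =>
      Some (nset s x (nreg s y * nreg s z)%N,
            ((1 + bitlen (nreg s y)) * (1 + bitlen (nreg s z)))%N)
  | NHalf x y =>
      Some (nset s x (nreg s y)./2, (1 + bitlen (nreg s y))%N)
  | NFlip x =>
      if coins s is b :: cs
      then Some (State (upd (nreg s) x (b : nat)) (sreg s) cs (asked s), 1%N)
      else None
  | SSize x u =>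
      Some (nset s x (size (sreg s u)), (1 + size (sreg s u))%N)
  | SCopy u v =>
      Some (sset s u (sreg s v), (1 + size (sreg s v))%N)
  | SMul u v w =>
      let p := mul O (sreg s v) (sreg s w) in
      Some (sset s u p,
            (1 + size (sreg s v) + size (sreg s w) + size p
             + mulcost O (sreg s v) (sreg s w))%N)
  | DLog x u v =>
      Some (State (upd (nreg s) x (dlog O (asked s) (sreg s u) (sreg s v)))
                  (sreg s) (coins s) ((sreg s u, sreg s v) :: asked s), 1%N)
  end.

Definition test_val (b : test) (s : state) : bool :=
  match b with
  | NLt x y => (nreg s x < nreg s y)%N
  | NOdd x => odd (nreg s x)
  | SEq u v => sreg s u == sreg s v
  end.

(* Comparing two numbers takes no longer than reading the shorter one.  This
   lets a program discard an overlong answer of the oracle without reading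
   all of it. *)
Definition test_cost (b : test) (s : state) : nat :=
  match b with
  | NLt x y => 1 + minn (bitlen (nreg s x)) (bitlen (nreg s y))
  | NOdd x => 1
  | SEq u v => 1 + size (sreg s u) + size (sreg s v)
  end.

(* exec c s s' t: started in s, c halts in s' at total cost t. *)
Inductive exec : cmd -> state -> state -> nat -> Prop :=
| ExecOp o s s' t : op_step o s = Some (s', t) -> exec (Op o) s s' t
| ExecSeq c1 c2 s s' s'' t t' :
    exec c1 s s' t -> exec c2 s' s'' t' -> exec (Seq c1 c2) s s'' (t + t')
| ExecIfT b c1 c2 s s' t : test_val b s ->
    exec c1 s s' t -> exec (If b c1 c2) s s' (test_cost b s + t)
| ExecIfF b c1 c2 s s' t : ~~ test_val b s ->
    exec c2 s s' t -> exec (If b c1 c2) s s' (test_cost b s + t)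
| ExecWhileT b c s s' s'' t t' : test_val b s ->
    exec c s s' t -> exec (While b c) s' s'' t' ->
    exec (While b c) s s'' (test_cost b s + t + t')
| ExecWhileF b c s : ~~ test_val b s ->
    exec (While b c) s s (test_cost b s).

(* The inputs u, v are in string registers 0 and 1, the output k is left in
   numeric register 0. *)
Definition init (u v : bitseq) (cs : seq bool) : state :=
  State (fun=> 0%N) (nth [::] [:: u; v]) cs [::].

Definition outputs (P : cmd) (u v : bitseq) (cs : seq bool) (k t : nat) : Prop :=
  exists2 s, exec P (init u v cs) s t & nreg s 0 = k.

End Semantics.

(* Nothing is assumed on inputs that do not represent powers of g. *)
Definition multiplies (R : realType) (S : semigroupType) (rep : S -> bitseq)
    (g : S) (pm : {poly R}) (O : oracles) : Prop :=
  forall a b, powers g a -> powers g b ->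
    mul O (rep a) (rep b) = rep (a * b)%g /\
    (mulcost O (rep a) (rep b))%:R <= pm.[kappa R rep g].

(* Nothing is assumed on inputs (r, u) where r does not represent a generator
   of G or u does not represent a power of it. *)
Definition DLP_oracle (R : realType) (S : semigroupType) (rep : S -> bitseq)
    (g : S) (G : set S) (po : {poly R}) (O : oracles) : Prop :=
  forall hist r u, generates r G -> powers r u ->
    let k := dlog O hist (rep r) (rep u) in
    [/\ (0 < k)%N, u = spow r k & (bitlen k)%:R <= po.[kappa R rep g]].

(* Probability of E for T independent fair coins. *)
Definition Pr (R : realType) (T : nat) (E : T.-tuple bool -> Prop) : R :=
  #|[pred cs : T.-tuple bool | `[< E cs >]]|%:R / 2 ^+ T.

(* Main.v *)
Require Import Defs.
From mathcomp Require Import all_boot all_order all_algebra.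
From mathcomp Require Import finmap.
From mathcomp Require Import boolp classical_sets cardinality reals exp.
From mathcomp Require Import zify ring lra.

Set Implicit Arguments.
Unset Strict Implicit.
Unset Printing Implicit Defensive.

Import Order.TTheory GRing.Theory Num.Theory.
Local Open Scope ring_scope.

(* The reduction is deterministic.  An element r = g ^ m with m >= l and m prime
   to n generates G, and the oracle with base r decides membership in G: v is in
   G if and only if r ^ dlog(r, v) = v, whatever the oracle answers outside G.
   If h = g ^ x is in G, then m * dlog(r, h) is an exponent of h.  Otherwise
   x < l, bisection finds for u = g and u = h the largest c >= 0 such that
   u * g ^ c is not in G, namely l - 2 and l - x - 1, and x is the difference of
   these numbers plus 1.

   For fixed K the numbers 1 + j * K! with 1 <= j <= K are pairwise coprime
   (Goedel's beta function), so one of them is prime to n as soon as n < 2 ^ K.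
   The program therefore runs through the pairs (K, j), tries m = 1 + j * K!,
   discards oracle answers >= K!, and stops when the candidate k satisfies
   g ^ k = h.  This happens before K exceeds a polynomial in kappa(g). *)

(** * Powers in a semigroup, index and period, and the cyclic group [periodic_part] *)

Section SemigroupPowers.
Local Open Scope nat_scope.
Variable S : semigroupType.
Implicit Types (g a b : S).

Lemma spowS g k : 0 < k -> spow g k.+1 = (spow g k * g)%g.
Proof. by case: k. Qed.

Lemma spowD g i j : 0 < i -> 0 < j ->
  spow g (i + j) = (spow g i * spow g j)%g.
Proof.
move=> i_gt0; elim: j => // [[|j]] IH _; first by rewrite addn1 spowS.
by rewrite addnS spowS ?addn_gt0 ?i_gt0 // IH // [in RHS]spowS // mulgA.
Qed.

Lemma spowM g i j : 0 < i -> 0 < j -> spow (spow g i) j = spow g (i * j).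
Proof.
move=> i_gt0; elim: j => // [[|j]] IH _; first by rewrite muln1.
by rewrite spowS // IH // [in RHS]mulnS addnC spowD // muln_gt0 i_gt0.
Qed.

Lemma spow_predK g k : spow g k.-1.+1 = spow g k.
Proof. by []. Qed.

Lemma powers_spow g k : powers g (spow g k).
Proof. by exists k.-1.+1. Qed.

Lemma powersM g a b : powers g a -> powers g b -> powers g (a * b)%g.
Proof.
move=> [i i_gt0 ->] [j j_gt0 ->]; rewrite -spowD //; exact: powers_spow.
Qed.

Lemma powers_spowW g a k : powers g a -> powers g (spow a k).
Proof.
move=> [i i_gt0 ->]; rewrite -spow_predK spowM //; exact: powers_spow.
Qed.

Section IndexPeriod.
Variables (g : S) (l n : nat).
Hypothesis minln : minimal_index_period g l n.

Let G : set S := periodic_part g l n.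

Lemma index_gt0 : 0 < l. Proof. by case: minln. Qed.

(** The induction removes one period at a time: the exponent is split off as [l + n] plus a
    remainder, and [l + n] is replaced by [l]. *)
Lemma spow_addMn i k : l <= i -> spow g (i + k * n) = spow g i.
Proof.
have [l_gt0 n_gt0 Eln _] := minln.
move=> le_li; elim: k => [|k <-]; first by rewrite addn0.
have -> : i + k.+1 * n = (l + n) + (i - l + k * n) by lia.
(* [spowD] needs positive exponents, so an empty remainder is treated apart. *)
have [E|p_gt0] := posnP (i - l + k * n).
  by rewrite E addn0 Eln; congr spow; lia.
by rewrite spowD ?(ltn_addr n l_gt0) // Eln -spowD //; congr spow; lia.
Qed.

Lemma spow_eqmod i j : l <= i -> l <= j -> i = j %[mod n] ->
  spow g i = spow g j.
Proof.
wlog le_ij : i j / i <= j => [W li lj E|li lj /esym/eqP].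
  by case: (leqP i j) => [|/ltnW] /W-> //.
rewrite eqn_mod_dvd // => /dvdnP[k E].
by rewrite -(subnKC le_ij) E spow_addMn.
Qed.

(** Minimality for the exponent [i] and the period [j - i] gives [l <= i]. From [l] on, exponents
    may be reduced modulo [n], so a nonzero remainder of [j - i] would be a period shorter than
    [n]. *)
Lemma spow_eq_lt i j : 0 < i -> i < j -> spow g i = spow g j ->
  l <= i /\ n %| j - i.
Proof.
have [l_gt0 n_gt0 Eln lnP] := minln.
move=> i_gt0 lt_ij E; pose d := j - i.
have d_gt0 : 0 < d by rewrite subn_gt0.
have Ed : spow g (i + d) = spow g i by rewrite subnKC // ltnW.
have [le_li _] := lnP _ _ i_gt0 d_gt0 Ed; split=> //.
have [r0|r_gt0] := posnP (d %% n); first by rewrite /dvdn r0.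
have Er : spow g (i + d %% n) = spow g i.
  by rewrite -Ed; apply: spow_eqmod; rewrite ?modnDmr //; lia.
have [_] := lnP _ _ i_gt0 r_gt0 Er.
by rewrite leqNgt ltn_mod n_gt0.
Qed.

Lemma periodic_part_spow i : 0 < i -> G (spow g i) <-> l <= i.
Proof.
have [l_gt0 n_gt0 Eln lnP] := minln.
move=> i_gt0; split=> [[k _ E]|le_li].
  have [//|lt_il] := leqP l i.
  have [|//] := spow_eq_lt i_gt0 _ E; lia.
exists ((i - l) %% n); first by rewrite ltn_mod.
by apply: spow_eqmod; rewrite ?leq_addr // modnDmr subnKC.
Qed.

Lemma periodic_partP a : G a <-> exists2 i, l <= i & a = spow g i.
Proof.
split=> [[k _ ->]|[i le_li ->]]; first by exists (l + k); rewrite ?leq_addr.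
by rewrite periodic_part_spow // (leq_trans index_gt0).
Qed.

(** Coprimality provides an inverse [u] of [m] modulo [n], so raising [g ^ m] to a power congruent
    to [u * i] yields [g ^ i]. *)
Lemma generates_spow m : l <= m -> coprime m n -> generates (spow g m) G.
Proof.
move=> le_lm co_mn; have [l_gt0 n_gt0 _ _] := minln.
have m_gt0 : 0 < m by rewrite (leq_trans l_gt0).
apply/seteqP; split=> [a [k k_gt0 ->]|a /periodic_partP[i le_li ->]].
  rewrite spowM //; apply/periodic_partP; exists (m * k) => //.
  by rewrite (leq_trans le_lm) // leq_pmulr.
case: (egcdnP n m_gt0) => u v E _.
have {E} Eu : u * m = 1 %[mod n].
  by rewrite E (eqP co_mn) modnMDl.
have i_gt0 : 0 < i := leq_trans l_gt0 le_li.
(* Adding [n] makes the exponent positive whatever [u] is and changes nothing modulo [n]. *)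
exists (u * i + n) => /=; first by rewrite addn_gt0 n_gt0 orbT.
rewrite spowM ?addn_gt0 ?n_gt0 ?orbT //; apply: spow_eqmod => //.
  by rewrite (leq_trans le_lm) // leq_pmulr // addn_gt0 n_gt0 orbT.
rewrite mulnDr addnC modnMDl mulnA [m * u]mulnC.
by rewrite -modnMml Eu modnMml mul1n.
Qed.

(** The exponent [l * n] is at least [l] and divisible by [n], so it gives the neutral element;
    [l * n + 1] gives a generator, and [i * n.-1 + l * n], congruent to [-i] modulo [n], gives the
    inverse of [g ^ i]. *)
Lemma periodic_part_cyclic : cyclic_subgroup G.
Proof.
have [l_gt0 n_gt0 _ _] := minln.
have le_lln : l <= l * n by rewrite leq_pmulr.
split; last first.
  exists (spow g (l * n + 1)); apply: generates_spow.
    by rewrite (leq_trans le_lln) // leq_addr.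
  by rewrite /coprime -gcdn_modl modnMDl gcdn_modl gcd1n.
split.
  move=> a b /periodic_partP[i li ->] /periodic_partP[j lj ->].
  rewrite -spowD ?(leq_trans l_gt0) //; apply/periodic_partP.
  by exists (i + j) => //; rewrite (leq_trans li) // leq_addr.
exists (spow g (l * n)); split.
- by apply/periodic_partP; exists (l * n).
- move=> a /periodic_partP[i li ->].
  rewrite -!spowD ?(leq_trans l_gt0) //; split; apply: spow_eqmod => //; try lia.
    by rewrite modnMDl.
  by rewrite addnC modnMDl.
move=> a /periodic_partP[i li ->].
have i_gt0 : 0 < i := leq_trans l_gt0 li.
have le_lj : l <= i * n.-1 + l * n by rewrite (leq_trans le_lln) // leq_addl.
exists (spow g (i * n.-1 + l * n)); split.
- by apply/periodic_partP; exists (i * n.-1 + l * n).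
- rewrite -spowD ?(leq_trans l_gt0) //.
  apply: spow_eqmod => //; first lia.
  by rewrite addnA -mulnS (prednK n_gt0) modnMDl.
rewrite -spowD ?(leq_trans l_gt0) //.
apply: spow_eqmod => //; first lia.
by rewrite addnC addnA -mulnS (prednK n_gt0) modnMDl.
Qed.

(** The powers with exponents 1 to [l + n - 1] are distinct: a coincidence at [i < j] forces
    [l <= i] and [n <= j - i], hence [l + n <= j]. Through this, [kappa] bounds index and period. *)
Lemma leq_sorder : periodic S -> l + n <= (sorder g).+1.
Proof.
have [l_gt0 n_gt0 _ lnP] := minln.
move=> /(_ g) fin_g; pose s := [seq spow g i.+1 | i <- iota 0 (l + n).-1].
rewrite -ltnS -(prednK (ltn_addr n l_gt0)) 2!ltnS.
have -> : (l + n).-1 = size s by rewrite size_map size_iota.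
rewrite /sorder; apply: uniq_leq_size => [|a].
  rewrite map_inj_in_uniq ?iota_uniq // => i j; rewrite !mem_iota /= add0n.
  wlog le_ij : i j / i <= j => [W li lj E|].
    by case: (leqP i j) => [|/ltnW] /W-> //.
  move=> lt_i lt_j E; case: (ltngtP i j) le_ij => // lt_ij _.
  have [//|le_li n_dvd] := spow_eq_lt (ltn0Sn i) _ E.
  by have := dvdn_leq _ n_dvd; lia.
case/mapP=> i _ ->; rewrite in_fset_set // inE; exact: powers_spow.
Qed.

End IndexPeriod.
End SemigroupPowers.

(** * A family of pairwise coprime numbers *)

Section CoprimeFamily.
Local Open Scope nat_scope.

(** A common prime divisor divides the difference [(j - i) * K!], hence [K!] because [j - i <= K],
    and therefore 1. *)
Lemma coprime_beta K i j : i < j <= K -> coprime (1 + i * K`!) (1 + j * K`!).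
Proof.
case/andP=> lt_ij le_jK; apply/negPn/negP=> nco.
have d_gt0 : 0 < gcdn (1 + i * K`!) (1 + j * K`!) by rewrite gcdn_gt0.
have d_gt1 : 1 < gcdn (1 + i * K`!) (1 + j * K`!) by move: nco; rewrite /coprime; lia.
pose p := pdiv (gcdn (1 + i * K`!) (1 + j * K`!)).
have p_pr : prime p := pdiv_prime d_gt1.
have : p %| gcdn (1 + i * K`!) (1 + j * K`!) := pdiv_dvd _.
rewrite dvdn_gcd => /andP[pi pj].
have pF : p %| K`!.
  have: p %| (j - i) * K`!.
    have -> : (j - i) * K`! = (1 + j * K`!) - (1 + i * K`!) by rewrite mulnBl subnDl.
    exact: dvdn_sub.
  rewrite Euclid_dvdM // => /orP[p_ji|//].
  by rewrite (dvdn_trans p_ji) // dvdn_fact // subn_gt0 lt_ij; lia.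
by move: pi; rewrite dvdn_addl ?dvdn_mull // dvdn1 => /eqP p1; rewrite p1 in p_pr.
Qed.

(* Otherwise n is a multiple of the K pairwise coprime numbers
   gcdn (1 + j * K`!) n > 1. *)
Lemma exists_coprime_beta K n : 0 < n -> n < 2 ^ K ->
  exists2 j, 0 < j <= K & coprime (1 + j * K`!) n.
Proof.
move=> n_gt0 lt_nK.
have [/existsP[j jP]|/existsPn no] :=
    boolP [exists j : 'I_K, coprime (1 + j.+1 * K`!) n].
  by exists j.+1; rewrite ?ltn_ord.
pose d j := gcdn (1 + j.+1 * K`!) n.
have d_gt1 j : j < K -> 1 < d j.
  by move=> ltj; have := no (Ordinal ltj); rewrite /coprime /d /= ltn_neqAle eq_sym gcdn_gt0 n_gt0 orbT => ->.
have H k : k <= K -> (\prod_(j < k) d j %| n) && (2 ^ k <= \prod_(j < k) d j).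
  elim: k => [|k IH] le_kK; first by rewrite !big_ord0 dvd1n.
  have /andP[dvd_k le_k] := IH (ltnW le_kK).
  rewrite big_ord_recr /= expnSr leq_mul ?d_gt1 // andbT Gauss_dvd ?dvd_k ?dvdn_gcdr //.
  rewrite coprime_sym; apply: (big_ind (fun x => coprime (d k) x)).
  - exact: coprimen1.
  - by move=> x y; rewrite coprimeMr => -> ->.
  move=> i _; rewrite coprime_sym.
  apply: (coprime_dvdl (dvdn_gcdl _ _)); apply: (coprime_dvdr (dvdn_gcdl _ _)).
  by apply: coprime_beta; rewrite ltnS ltn_ord.
have /andP[dvd_K le_K] := H K (leqnn _).
by have := dvdn_leq n_gt0 dvd_K; lia.
Qed.

Lemma leq_exp2_fact k : 2 ^ k <= k.+1`!.
Proof. by elim: k => // k IH; rewrite expnS factS leq_mul. Qed.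

End CoprimeFamily.

(** * The program of the reduction *)

Section Programs.
Local Open Scope nat_scope.

Local Notation "c1 ;; c2" := (Seq c1 c2) (at level 59, right associativity).

(* Numeric registers: 0 candidate, 1 and 2 the constants 1 and 0, 3 K, 4 j,
   5 K!, 6 m = 1 + j * K!, 7 exponent left in [power], 8 oracle answer, 9-11
   bisection, 12 success flag, 15 scratch.  String registers: 0 g, 1 h,
   2 r = g ^ m, 3 result of [power], 4 its running square, 5 element tested. *)
Definition skip := Op (NConst 15 0).

(* Starting the accumulator at the base avoids the missing neutral element. *)
Definition power (u x : nat) :=
  Op (SCopy 3 u) ;; Op (SCopy 4 u) ;; Op (NSub 7 x 1) ;;
  While (NLt 2 7)
    (If (NOdd 7) (Op (SMul 3 3 4)) skip ;; Op (SMul 4 4 4) ;; Op (NHalf 7 7)).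

(* Overlong answers are replaced by 0 without being read. *)
Definition ask (u : nat) :=
  Op (DLog 8 2 u) ;; If (NLt 8 5) skip (Op (NConst 8 0)).

(** Register 11 is the lower end and register 9 the width of the search interval. The midpoint
    rounds up, so rounding the width down is right for both halves. *)
Definition bisect (u : nat) :=
  Op (NConst 11 0) ;; Op (NAdd 9 5 2) ;;
  While (NLt 2 9)
    (Op (NAdd 10 9 11) ;; Op (NHalf 9 9) ;; Op (NSub 10 10 9) ;;
     power 0 10 ;; Op (SMul 5 u 3) ;; ask 5 ;; power 2 8 ;;
     If (SEq 3 5) skip (Op (NAdd 11 10 2))).

(** Subtracting and then adding 1 turns a candidate 0 into 1. The final test is not affected, since
    [spow g 0] is [g]. *)
Definition attempt :=
  Op (NMul 6 4 5) ;; Op (NAdd 6 6 1) ;; power 0 6 ;; Op (SCopy 2 3) ;;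
  ask 1 ;; Op (NMul 0 6 8) ;; power 0 0 ;;
  If (SEq 3 1) skip
    (bisect 0 ;; Op (NAdd 0 11 1) ;; bisect 1 ;; Op (NSub 0 0 11)) ;;
  Op (NSub 0 0 1) ;; Op (NAdd 0 0 1) ;; power 0 0 ;;
  If (SEq 3 1) (Op (NConst 12 1)) skip.

Definition advance :=
  If (NLt 4 3) (Op (NAdd 4 4 1))
    (Op (NAdd 3 3 1) ;; Op (NMul 5 5 3) ;; Op (NConst 4 1)).

(** The search starts at [K = j = 0] with [0! = 1] in register 5, so the first [advance] leads to
    [K = j = 1]. *)
Definition reduction :=
  Op (NConst 1 1) ;; Op (NConst 5 1) ;; While (NLt 12 1) (advance ;; attempt).

(** * Hoare rules for total correctness with a time bound *)

Section Hoare.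
Variables (O : oracles) (W : nat).
Implicit Types (s : state) (Q : state -> Prop).

(* Running times are counted in units of W, a bound on the charge of each
   single instruction and test. *)
Definition runs c s B Q :=
  exists s' t, [/\ exec O c s s' t, t <= B * W & Q s'].

Lemma runs_weaken c s B B' Q Q' : runs c s B Q -> B <= B' ->
  (forall s', Q s' -> Q' s') -> runs c s B' Q'.
Proof.
move=> [s' [t [e le_t q]]] le_B QQ'; exists s', t; split=> //; last exact: QQ'.
by rewrite (leq_trans le_t) // leq_mul2r le_B orbT.
Qed.

Lemma runs_leq c s B B' Q : B <= B' -> runs c s B Q -> runs c s B' Q.
Proof. by move=> le_B /runs_weaken; apply. Qed.

Lemma runs_op o s s' t Q : op_step O o s = Some (s', t) -> t <= W -> Q s' ->
  runs (Op o) s 1 Q.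
Proof. by move=> E le_t q; exists s', t; split; rewrite ?mul1n //; constructor. Qed.

(** The run of [c2] is nested in the postcondition of [c1], so that proofs execute programs forward
    without naming intermediate assertions. *)
Lemma runs_seq c1 c2 s B1 B2 Q :
  runs c1 s B1 (fun s' => runs c2 s' B2 Q) -> runs (c1 ;; c2) s (B1 + B2) Q.
Proof.
move=> [s1 [t1 [e1 le1 [s2 [t2 [e2 le2 q]]]]]]; exists s2, (t1 + t2).
by split=> //; [apply: ExecSeq e1 e2 | rewrite mulnDl leq_add].
Qed.

Lemma runs_if b c1 c2 s B Q : test_cost b s <= W ->
  runs (if test_val b s then c1 else c2) s B Q -> runs (If b c1 c2) s (1 + B) Q.
Proof.
move=> le_b; case: ifPn => tb [s' [t [e le_t q]]];
  exists s', (test_cost b s + t); split; rewrite ?mulnDl ?mul1n ?leq_add //.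
  exact: ExecIfT.
exact: ExecIfF.
Qed.

(** The variant [mu] bounds the number of rounds, each one test and one body; the last unit pays for
    the failing test. *)
Lemma runs_while b c s B (mu : state -> nat) (Inv : state -> Prop) Q :
  Inv s -> (forall s, Inv s -> test_cost b s <= W) ->
  (forall s, Inv s -> test_val b s ->
     runs c s B (fun s' => Inv s' /\ mu s' < mu s)) ->
  (forall s, Inv s -> ~~ test_val b s -> Q s) ->
  runs (While b c) s (mu s * (1 + B) + 1) Q.
Proof.
move=> + le_b body post; have [k] := ubnP (mu s); elim: k s => // k IH s lt_k inv_s.
have [tb|tb] := boolP (test_val b s); last first.
  exists s, (test_cost b s); split; [exact: ExecWhileF | | exact: post].
  by rewrite mulnDl mul1n (leq_trans (le_b _ inv_s)) // leq_addl.
have [s1 [t1 [e1 le1 [inv_1 lt_1]]]] := body s inv_s tb.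
have [s2 [t2 [e2 le2 q]]] := IH s1 (leq_trans lt_1 lt_k) inv_1.
exists s2, (test_cost b s + t1 + t2); split=> //; first exact: ExecWhileT e1 e2.
apply: (@leq_trans ((1 + B) * W + (mu s1 * (1 + B) + 1) * W)).
  by rewrite leq_add // mulnDl mul1n leq_add // le_b.
rewrite -mulnDl leq_mul2r; apply/orP; right.
by rewrite addnA leq_add2r -mulSn leq_mul2r lt_1 orbT.
Qed.

End Hoare.

(** A frame condition: [xs] and [us] list the numeric and string registers that may have changed. *)
Definition agree_off (xs us : seq nat) (s s' : state) :=
  (forall x, x \notin xs -> nreg s' x = nreg s x) /\
  (forall u, u \notin us -> sreg s' u = sreg s u).

Lemma agree_off_refl xs us s : agree_off xs us s s.
Proof. by []. Qed.

Lemma agree_off_trans xs us xs' us' s1 s2 s3 :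
  agree_off xs us s1 s2 -> agree_off xs' us' s2 s3 ->
  {subset xs' <= xs} -> {subset us' <= us} -> agree_off xs us s1 s3.
Proof.
move=> [n1 z1] [n2 z2] sx su; split=> [x xN|u uN].
  by rewrite n2 ?n1 //; apply: contra xN => /sx.
by rewrite z2 ?z1 //; apply: contra uN => /su.
Qed.

Lemma agree_off_nset xs us s s' x k :
  agree_off xs us s s' -> x \in xs -> agree_off xs us s (nset s' x k).
Proof.
move=> [n1 z1] x_xs; split=> [y yN|u uN] /=; last exact: z1.
by rewrite /upd; case: eqP => [E|_]; [rewrite E x_xs in yN | exact: n1].
Qed.

Lemma agree_off_sset xs us s s' u w :
  agree_off xs us s s' -> u \in us -> agree_off xs us s (sset s' u w).
Proof.
move=> [n1 z1] u_us; split=> [x xN|v vN] /=; first exact: n1.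
by rewrite /upd; case: eqP => [E|_]; [rewrite E u_us in vN | exact: z1].
Qed.

Lemma bitlen_leq k b : k < 2 ^ b -> bitlen k <= b.
Proof. by move=> lt_k; apply: up_log_min. Qed.

Lemma bitlen_half k : 0 < k -> bitlen k./2 < bitlen k.
Proof. by move=> k_gt0; rewrite /bitlen (up_log2S k_gt0). Qed.

(** * Correctness and running time of the program, given bounds on all sizes *)

Section Correctness.
Variables (S : semigroupType) (rep : S -> bitseq) (O : oracles) (g h : S).
Variables (L M bl : nat).
Hypothesis rep_inj : injective rep.
Hypothesis h_pow : powers g h.
Hypothesis mulE : forall a b, powers g a -> powers g b ->
  Defs.mul O (rep a) (rep b) = rep (a * b)%g.
Hypothesis mulcost_leq : forall a b, powers g a -> powers g b ->
  mulcost O (rep a) (rep b) <= M.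
Hypothesis size_leq : forall a, powers g a -> size (rep a) <= L.
Hypothesis bl_gt0 : 0 < bl.

(** The square pays for a product of two numbers of [bl] bits; [3 * L + M + 1] pays for a semigroup
    product with its two factors and its result. *)
Definition unit_cost := (1 + bl) * (1 + bl) + 3 * L + M + 1.
Local Notation W := unit_cost.
Local Notation fits k := (k < 2 ^ bl).

Lemma fitsW j k : j <= k -> fits k -> fits j.
Proof. exact: leq_ltn_trans. Qed.

Lemma fits1 : fits 1.
Proof. by rewrite -{1}(expn0 2) ltn_exp2l. Qed.

Implicit Type Q : state -> Prop.

Lemma runs_NConst x k s Q : k <= 1 -> Q (nset s x k) ->
  runs O W (Op (NConst x k)) s 1 Q.
Proof.
move=> k1; apply: runs_op => //=.
have := bitlen_leq (fitsW k1 fits1); rewrite /W; lia.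
Qed.

Lemma runs_NAdd x y z s Q : fits (nreg s y) -> fits (nreg s z) ->
  Q (nset s x (nreg s y + nreg s z)) -> runs O W (Op (NAdd x y z)) s 1 Q.
Proof.
move=> /bitlen_leq fy /bitlen_leq fz; apply: runs_op => //=; rewrite /W; lia.
Qed.

Lemma runs_NSub x y z s Q : fits (nreg s y) -> fits (nreg s z) ->
  Q (nset s x (nreg s y - nreg s z)) -> runs O W (Op (NSub x y z)) s 1 Q.
Proof.
move=> /bitlen_leq fy /bitlen_leq fz; apply: runs_op => //=; rewrite /W; lia.
Qed.

Lemma runs_NMul x y z s Q : fits (nreg s y) -> fits (nreg s z) ->
  Q (nset s x (nreg s y * nreg s z)) -> runs O W (Op (NMul x y z)) s 1 Q.
Proof.
move=> /bitlen_leq fy /bitlen_leq fz; apply: runs_op => //=.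
rewrite /W -!addnA (leq_trans _ (leq_addr _ _)) //.
by rewrite leq_mul // leq_add2l.
Qed.

Lemma runs_NHalf x y s Q : fits (nreg s y) ->
  Q (nset s x (nreg s y)./2) -> runs O W (Op (NHalf x y)) s 1 Q.
Proof. move=> /bitlen_leq fy; apply: runs_op => //=; rewrite /W; lia. Qed.

Lemma runs_SCopy u v s a Q : powers g a -> sreg s v = rep a ->
  Q (sset s u (rep a)) -> runs O W (Op (SCopy u v)) s 1 Q.
Proof.
move=> /size_leq sa Ea q; apply: runs_op; first by [].
  by rewrite Ea /W; lia.
by rewrite Ea.
Qed.

Lemma runs_SMul u v w s a b Q : powers g a -> powers g b ->
  sreg s v = rep a -> sreg s w = rep b ->
  Q (sset s u (rep (a * b)%g)) -> runs O W (Op (SMul u v w)) s 1 Q.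
Proof.
move=> pa pb Ea Eb q; apply: runs_op; first by [].
  rewrite Ea Eb mulE //.
  have := mulcost_leq pa pb; have := size_leq (powersM pa pb).
  by have := size_leq pa; have := size_leq pb; rewrite /W; lia.
by rewrite Ea Eb mulE.
Qed.

Lemma test_cost_NLt x y s : fits (nreg s y) -> test_cost (NLt x y) s <= W.
Proof. move=> /bitlen_leq fy /=; rewrite /W; lia. Qed.

Lemma test_cost_SEq u v s a b : powers g a -> powers g b ->
  sreg s u = rep a -> sreg s v = rep b -> test_cost (SEq u v) s <= W.
Proof.
move=> /size_leq sa /size_leq sb /= -> ->; rewrite /W; lia.
Qed.

Definition consts (s : state) := nreg s 1 = 1 /\ nreg s 2 = 0.

Lemma consts_agree xs us s s' : agree_off xs us s s' ->
  1 \notin xs -> 2 \notin xs -> consts s -> consts s'.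
Proof. by move=> [n1 _] N1 N2 [c1 c2]; split; rewrite n1. Qed.

Definition power_cost := 3 + (bl * 5 + 1).

(** Binary powering keeps [i + d * e] constant, where string registers 3 and 4 hold [a ^ i] and
    [a ^ d] and register 7 holds [e]. For exponent 0 truncated subtraction leaves [a], in agreement
    with [spow a 0]. *)
Lemma runs_power u x s a : consts s -> powers g a -> sreg s u = rep a ->
  fits (nreg s x) -> u != 3 ->
  runs O W (power u x) s power_cost (fun s' =>
    agree_off [:: 7; 15] [:: 3; 4] s s' /\
    sreg s' 3 = rep (spow a (nreg s x))).
Proof.
move=> [c1 c2] pa Ea fx u3.
apply: (@runs_leq _ _ _ _ (1 + (1 + (1 + (bitlen (nreg s x - 1) * (1 + 4) + 1))))).
  have := bitlen_leq (fitsW (leq_subr 1 _) fx); rewrite /power_cost; lia.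
apply: runs_seq; apply: (runs_SCopy pa Ea).
apply: runs_seq; apply: (runs_SCopy pa) => /=; first by rewrite /upd (negbTE u3).
apply: runs_seq; apply: runs_NSub => //=; first by rewrite c1 fits1.
set s1 := nset _ _ _.
pose Inv s' : Prop := (agree_off [:: 7; 15] [:: 3; 4] s s' /\
  exists i d, [/\ 0 < i, 0 < d, sreg s' 3 = rep (spow a i),
    sreg s' 4 = rep (spow a d) & i + d * nreg s' 7 = (nreg s x).-1.+1]).
have -> : nreg s x - 1 = nreg s1 7 by rewrite /s1 /= /upd /= c1.
apply: (@runs_while _ _ _ _ _ _ (fun s => bitlen (nreg s 7)) Inv).
- split; first by apply: agree_off_nset => //; do 2![apply: agree_off_sset => //].
  by exists 1, 1; rewrite /s1 /= /upd /= c1; split=> //; lia.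
- move=> s' [Es [i [d [i0 d0 _ _ E]]]]; apply: test_cost_NLt.
  have : i + nreg s' 7 <= (nreg s x).-1.+1 by rewrite -E leq_add2l leq_pmull.
  by move=> le7; apply: fitsW fx; lia.
- move=> s' [Es [i [d [i0 d0 E3 E4 E]]]] /=.
  have [_ c2'] := consts_agree Es isT isT (conj c1 c2); rewrite c2' => e0.
  have f7 : fits (nreg s' 7).
    have : i + nreg s' 7 <= (nreg s x).-1.+1 by rewrite -E leq_add2l leq_pmull.
    by move=> le7; apply: fitsW fx; lia.
  have pd := powers_spowW d pa; have pi := powers_spowW i pa.
  apply: (@runs_seq _ _ _ _ _ 2 2).
  apply: (@runs_if _ _ _ _ _ _ 1) => /=; first by rewrite /W; lia.
  have step s2 : nreg s2 7 = nreg s' 7 -> sreg s2 4 = sreg s' 4 ->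
      agree_off [:: 7; 15] [:: 3; 4] s s2 ->
      sreg s2 3 = rep (spow a (i + odd (nreg s' 7) * d)) ->
      runs O W (Op (SMul 4 4 4) ;; Op (NHalf 7 7)) s2 2
        (fun s' => Inv s' /\ bitlen (nreg s' 7) < bitlen (nreg s2 7)).
    move=> E7 E24 As2 E23; apply: (@runs_seq _ _ _ _ _ 1 1).
    apply: (runs_SMul pd pd); rewrite ?E24 // -spowD //.
    apply: runs_NHalf => /=; first by rewrite E7.
    split; last by rewrite /= /upd /= E7 bitlen_half.
    split; first by apply: agree_off_nset => //; apply: agree_off_sset.
    exists (i + odd (nreg s' 7) * d), (d + d); rewrite /= /upd /= E7.
    split=> //; try by rewrite addn_gt0 ?i0 ?d0.
    rewrite -E -{3}(odd_double_half (nreg s' 7)); nia.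
  case: ifPn => odd7.
    apply: (runs_SMul pi pd E3 E4); rewrite -spowD //.
    apply: step => //; first exact: agree_off_sset.
    by rewrite /= /upd /= odd7 mul1n.
  apply: runs_NConst => //; apply: step => //; first exact: agree_off_nset.
  by rewrite /= (negbTE odd7) mul0n addn0 E3.
move=> s' [Es [i [d [i0 d0 E3 E4 E]]]] /=.
have [_ ->] := consts_agree Es isT isT (conj c1 c2).
rewrite -leqNgt leqn0 => /eqP e0; split=> //.
by rewrite E3 -(spow_predK a (nreg s x)) -E e0 muln0 addn0.
Qed.

(** All histories are covered because equal calls may be answered differently; answers below [F] are
    those that [ask] keeps. *)
Definition solved (r v : S) F := forall hist,
  let k := dlog O hist (rep r) (rep v) in [/\ 0 < k, k < F & spow r k = v].

Lemma runs_ask u s r v F : nreg s 5 = F -> 0 < F -> fits F ->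
  sreg s 2 = rep r -> sreg s u = rep v ->
  runs O W (ask u) s 3 (fun s' => [/\ agree_off [:: 8; 15] [::] s s',
    nreg s' 8 < F & solved r v F -> 0 < nreg s' 8 /\ spow r (nreg s' 8) = v]).
Proof.
move=> E5 F_gt0 fF E2 Eu; apply: (@runs_seq _ _ _ _ _ 1 2).
apply: runs_op; [by [] | by rewrite /W; lia |].
set s1 := State _ _ _ _.
have As1 : agree_off [:: 8; 15] [::] s s1.
  by split=> // x /=; rewrite /upd; case: eqP => [->|].
have E8 : nreg s1 8 = dlog O (asked s) (rep r) (rep v) by rewrite /s1 /= -E2 -Eu.
have E5' : nreg s1 5 = F by [].
(* The comparison is charged by its shorter operand, so register 5 bounds its cost however long the
   answer is. *)
apply: (@runs_if _ _ _ _ _ _ 1); first by apply: test_cost_NLt; rewrite E5'.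
rewrite /test_val E5'; case: ifPn => lt_k; apply: runs_NConst => //.
  split; [exact: agree_off_nset | exact: lt_k |].
  by move=> /(_ (asked s)); rewrite -E8 => -[].
split=> //; first exact: agree_off_nset.
by move=> /(_ (asked s)); rewrite -E8 => -[_ lt_k' _]; rewrite lt_k' in lt_k.
Qed.

(* Stated with [solved], so that the capped oracle detects all c > d. *)
Definition threshold (r u : S) F d := d <= F /\ forall c, 0 < c ->
  (d < c -> solved r (u * spow g c)%g F) /\
  (c <= d -> forall k, spow r k <> (u * spow g c)%g).

Definition bisect_cost := 2 +
  (bl * (1 + (3 + (power_cost + (1 + (3 + (power_cost + 2)))))) + 1).

Lemma runs_bisect u s r a F : consts s -> nreg s 5 = F -> 0 < F -> fits F ->
  powers g r -> powers g a ->
  sreg s 0 = rep g -> sreg s 2 = rep r -> sreg s u = rep a ->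
  u \notin [:: 3; 4; 5] ->
  runs O W (bisect u) s bisect_cost (fun s' =>
    [/\ agree_off [:: 7; 8; 9; 10; 11; 15] [:: 3; 4; 5] s s',
        nreg s' 11 <= F & forall d, threshold r a F d -> nreg s' 11 = d]).
Proof.
move=> cs E5 F_gt0 fF pr pa E0 E2 Eu uN; have [c1 c2] := cs.
pose xs := [:: 7; 8; 9; 10; 11; 15]; pose us := [:: 3; 4; 5].
apply: (@runs_leq _ _ _ _ (1 + (1 + (bitlen F *
  (1 + (1 + (1 + (1 + (power_cost + (1 + (3 + (power_cost + 2)))))))) + 1)))).
  have := bitlen_leq fF; rewrite /bisect_cost -!addnA !leq_add2l => le_bl.
  by rewrite leq_add2r leq_mul2r le_bl orbT.
apply: runs_seq; apply: runs_NConst => //.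
apply: runs_seq; apply: runs_NAdd; try by rewrite /= /upd /= ?E5 ?c2 (fitsW _ fF).
set s1 := nset _ _ _.
pose Inv s' := [/\ agree_off xs us s s', nreg s' 11 + nreg s' 9 <= F
  & forall d, threshold r a F d -> nreg s' 11 <= d <= nreg s' 11 + nreg s' 9].
have E19 : nreg s1 9 = F by rewrite /s1 /= /upd /= E5 c2 addn0.
rewrite -{1}E19.
apply: (@runs_while _ _ _ _ _ _ (fun s => bitlen (nreg s 9)) Inv).
- split; first by do 2![apply: agree_off_nset => //].
    by rewrite E19.
  by move=> d [le_d _]; rewrite E19.
- by move=> s' [_ le_F _]; apply: test_cost_NLt; apply: fitsW fF; lia.
- move=> s' [As' le_F thr] /=.
  have [c1' c2'] := consts_agree As' isT isT cs; rewrite c2' => e_gt0.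
  set c := nreg s' 11 in le_F thr *; set e := nreg s' 9 in le_F thr e_gt0 *.
  have fk k : k <= F -> fits k by move=> le_k; apply: fitsW fF.
  apply: runs_seq; apply: runs_NAdd; try by apply: fk; lia.
  apply: runs_seq; apply: runs_NHalf; first by apply: fk; rewrite /= /upd /=; lia.
  apply: runs_seq; apply: runs_NSub; try by apply: fk; rewrite /= /upd /= -/e -/c; lia.
  set s2 := nset _ _ _.
  have {As'} As2 : agree_off xs us s s2 by do 3![apply: agree_off_nset => //].
  have E9 : nreg s2 9 = e./2 by [].
  have E10 : nreg s2 10 = e + c - e./2 by [].
  have E11 : nreg s2 11 = c by [].
  clearbody s2 c e; clear s' c1' c2'.
  apply: runs_seq; apply: runs_weaken (leqnn _) _.
    apply: (runs_power _ (powers_spow g 1)) => //.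
    - exact: consts_agree As2 _ _ cs.
    - by rewrite As2.2.
    - by rewrite E10; apply: fk; lia.
  move=> s3 [A3 E3].
  have As3 : agree_off xs us s s3 by apply: (agree_off_trans As2 A3); apply/allP.
  rewrite E10 in E3; set b := e + c - e./2 in E10 E3.
  have pb := powers_spow g b; have pab := powersM pa pb.
  apply: runs_seq; apply: (runs_SMul pa pb) => //; first by rewrite As3.2.
  set s4 := sset _ _ _.
  have As4 : agree_off xs us s s4 by apply: agree_off_sset.
  apply: runs_seq; apply: runs_weaken (leqnn _) _.
    apply: (@runs_ask 5 s4 r (a * spow g b)%g F) => //.
      by rewrite As4.1.
    by rewrite As4.2.
  move=> s5 [A5 lt_k slv].
  have As5 : agree_off xs us s s5 by apply: (agree_off_trans As4 A5); apply/allP.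
  apply: runs_seq; apply: runs_weaken (leqnn _) _.
    apply: (runs_power _ pr) => //; first exact: consts_agree As5 _ _ cs.
      by rewrite As5.2.
    by apply: fk; apply: ltnW.
  move=> s6 [A6 E6].
  have As6 : agree_off xs us s s6 by apply: (agree_off_trans As5 A6); apply/allP.
  have E65 : sreg s6 5 = rep (a * spow g b)%g by rewrite A6.2 // A5.2.
  have E69 : nreg s6 9 = e./2 by rewrite A6.1 // A5.1 // A3.1.
  have E610 : nreg s6 10 = b by rewrite A6.1 // A5.1 // A3.1.
  have E611 : nreg s6 11 = c by rewrite A6.1 // A5.1 // A3.1.
  have [c1' c2'] := consts_agree As6 isT isT cs.
  have b_gt0 : 0 < b by rewrite /b; lia.
  apply: (@runs_if _ _ _ _ _ _ 1).
    exact: (test_cost_SEq (powers_spowW _ pr) pab E6 E65).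
  rewrite /test_val E6 E65; case: ifPn => [/eqP/rep_inj Erb|/eqP Nrb].
    apply: runs_NConst => //; split; last by rewrite /= /upd /= E69 bitlen_half.
    split; rewrite /= /upd /= ?E69 ?E611; [exact: agree_off_nset | lia |].
    move=> d thr_d; have := thr d thr_d; have [_ /(_ b b_gt0)[_ no]] := thr_d.
    (* For [b <= d] no power of [r] equals the element tested, so the successful comparison gives
       [d < b]. *)
    have lt_db : d < b by rewrite ltnNge; apply/negP=> /no/(_ (nreg s5 8)).
    by move: lt_db; rewrite /b; lia.
  apply: runs_NAdd; rewrite ?E610 ?c2'; try by apply: fk; rewrite /b; lia.
  split; last by rewrite /= /upd /= E69 bitlen_half.
  split; rewrite /= /upd /= ?E69 ?E611 ?addn0; [exact: agree_off_nset | rewrite /b; lia |].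
  move=> d thr_d; have := thr d thr_d; have [_ /(_ b b_gt0)[yes _]] := thr_d.
  (* For [d < b] the oracle's answer would have passed the comparison. *)
  have le_bd : b <= d.
    rewrite leqNgt; apply/negP=> /yes/slv[_ Erb]; by case: Nrb; rewrite Erb.
  by move: le_bd; rewrite /b; lia.
move=> s' [As' le_F thr] /=; have [_ ->] := consts_agree As' isT isT cs.
rewrite -leqNgt leqn0 => /eqP e0; rewrite e0 addn0 in thr le_F; split=> // d /thr.
by rewrite -eqn_leq => /eqP.
Qed.

Definition attempt_cost := 1 + (1 + (power_cost + (1 + (3 + (1 + (power_cost +
  (1 + (bisect_cost + (1 + (bisect_cost + 1))) +
  (1 + (1 + (power_cost + 2)))))))))).

(** The two ways in which a base [r] reveals an exponent of [h]: one logarithm, or the difference of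
    two thresholds. *)
Definition tractable (r : S) F := solved r h F \/
  exists dg dh, [/\ threshold r g F dg, threshold r h F dh &
    spow g (dg + 1 - dh) = h].

Definition success (s : state) :=
  [/\ nreg s 12 = 1, 0 < nreg s 0 & spow g (nreg s 0) = h].

(** The flag is raised only after [g ^ k] has been compared with [h], so bad oracle answers cannot
    cause a wrong output; [tractable] guarantees that the comparison succeeds. *)
Lemma runs_attempt s j F : consts s -> nreg s 4 = j -> nreg s 5 = F ->
  nreg s 12 = 0 -> sreg s 0 = rep g -> sreg s 1 = rep h -> 0 < F ->
  fits ((j * F + 1) * F + j + F + 1) ->
  runs O W attempt s attempt_cost (fun s' =>
    [/\ agree_off [:: 0; 6; 7; 8; 9; 10; 11; 12; 15] [:: 2; 3; 4; 5] s s',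
        nreg s' 12 = 0 \/ success s'
      & tractable (spow g (j * F + 1)) F -> success s']).
Proof.
move=> cs E4 E5 E12 E0 E1 F_gt0 ftop; have [c1 c2] := cs.
(* Register 12 is absent here: everything before the final test leaves the flag at 0. *)
pose xs := [:: 0; 6; 7; 8; 9; 10; 11; 15]; pose us := [:: 2; 3; 4; 5].
set m := j * F + 1; set r := spow g m; rewrite -/m in ftop.
have fk k : k <= m * F + j + F + 1 -> fits k by move=> le_k; apply: fitsW ftop.
have le_mF : m <= m * F by rewrite leq_pmulr.
have pg : powers g g := powers_spow g 1.
have pr : powers g r := powers_spow g m.
have As : agree_off xs us s s by [].
have fits_m k : k <= m -> fits k by move=> le_k; apply: fk; lia.
apply: runs_seq; apply: runs_NMul; rewrite ?E4 ?E5; try by apply: fk; lia.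
apply: runs_seq; apply: runs_NAdd; rewrite /= /upd /= ?c1; try by apply: fits_m; rewrite /m; lia.
set s1 := nset _ _ _.
have A1 : agree_off xs us s s1 by do 2![apply: agree_off_nset => //].
have E16 : nreg s1 6 = m by [].
clearbody s1.
apply: runs_seq; apply: runs_weaken (leqnn _) _.
  apply: (runs_power _ pg) => //; first exact: consts_agree A1 _ _ cs.
    by rewrite A1.2.
  by rewrite E16; apply: fits_m.
rewrite E16 => s2 [A12 E3].
have A2 : agree_off xs us s s2 by apply: (agree_off_trans A1 A12); apply/allP.
apply: runs_seq; apply: (runs_SCopy pr) => //.
set s3 := sset _ _ _.
have A3 : agree_off xs us s s3 by apply: agree_off_sset.
have E36 : nreg s3 6 = m by rewrite /= A12.1.
have E32 : sreg s3 2 = rep r by [].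
clearbody s3.
apply: runs_seq; apply: runs_weaken (leqnn _) _.
  apply: (@runs_ask 1 s3 r h F) => //; [by rewrite A3.1 | by apply: fk; lia |].
  by rewrite A3.2.
move=> s4 [A34 lt_k slv].
have A4 : agree_off xs us s s4 by apply: (agree_off_trans A3 A34); apply/allP.
have E42 : sreg s4 2 = rep r by rewrite A34.2.
have E46 : nreg s4 6 = m by rewrite A34.1.
set k := nreg s4 8 in lt_k slv.
have le_mk : m * k <= m * F by rewrite leq_mul2l ltnW // orbT.
apply: runs_seq; apply: runs_NMul; rewrite ?E46 -/k; [exact: fits_m | by apply: fk; lia |].
set s5 := nset _ _ _.
have A5 : agree_off xs us s s5 by apply: agree_off_nset.
have E50 : nreg s5 0 = m * k by [].
have E52 : sreg s5 2 = rep r by [].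
clearbody s5.
apply: runs_seq; apply: runs_weaken (leqnn _) _.
  apply: (runs_power _ pg) => //; first exact: consts_agree A5 _ _ cs.
    by rewrite A5.2.
  by rewrite E50; apply: fk; lia.
rewrite E50 => s6 [A56 E63].
have A6 : agree_off xs us s s6 by apply: (agree_off_trans A5 A56); apply/allP.
have E60 : nreg s6 0 = m * k by rewrite A56.1.
have E62 : sreg s6 2 = rep r by rewrite A56.2.
pose R s' := [/\ agree_off xs us s s', fits (nreg s' 0) &
  tractable r F -> spow g (nreg s' 0) = h].
have fallback : runs O W (if test_val (SEq 3 1) s6 then skip else
      bisect 0 ;; Op (NAdd 0 11 1) ;; bisect 1 ;; Op (NSub 0 0 11)) s6
    (bisect_cost + (1 + (bisect_cost + 1))) R.
  rewrite /test_val E63 A6.2 // E1; case: ifPn => [/eqP/rep_inj Eh|/eqP Nh].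
    apply: (@runs_leq _ _ _ _ 1); first lia.
    apply: runs_NConst => //; split=> /=; rewrite /upd /= ?E60 //.
      exact: agree_off_nset.
    by apply: fk; lia.
  apply: runs_seq; apply: runs_weaken (leqnn _) _.
    apply: (@runs_bisect 0 s6 r g F) => //.
    - exact: consts_agree A6 _ _ cs.
    - by rewrite A6.1.
    - by apply: fk; lia.
    - by rewrite A6.2.
    - by rewrite A6.2.
  move=> s7 [A67 le7 thr7].
  have A7 : agree_off xs us s s7 by apply: (agree_off_trans A6 A67); apply/allP.
  have [c1' c2'] := consts_agree A7 isT isT cs.
  apply: runs_seq; apply: runs_NAdd; rewrite ?c1'; try by apply: fk; lia.
  set s8 := nset _ _ _.
  have A8 : agree_off xs us s s8 by apply: agree_off_nset.
  have E80 : nreg s8 0 = nreg s7 11 + 1 by [].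
  have E82 : sreg s8 2 = rep r by rewrite /= A67.2.
  clearbody s8.
  apply: runs_seq; apply: runs_weaken (leqnn _) _.
    apply: (@runs_bisect 1 s8 r h F) => //.
    - exact: consts_agree A8 _ _ cs.
    - by rewrite A8.1.
    - by apply: fk; lia.
    - by rewrite A8.2.
    - by rewrite A8.2.
  move=> s9 [A89 le9 thr9].
  have A9 : agree_off xs us s s9 by apply: (agree_off_trans A8 A89); apply/allP.
  have E90 : nreg s9 0 = nreg s7 11 + 1 by rewrite A89.1.
  apply: runs_NSub; rewrite ?E90; try by apply: fk; lia.
  split; rewrite /= /upd /=; [exact: agree_off_nset | by apply: fk; lia |].
  (* If [h] were solved, the candidate [m * k] would have passed the test that leads here. *)
  case=> [/slv[k_gt0 Ek]|[dg [dh [/thr7-> /thr9-> //]]]].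
  by case: Nh; rewrite -Ek /r spowM // /m addn1.
apply: runs_seq; apply: runs_weaken (leqnn _) _.
  apply: runs_if fallback; apply: (test_cost_SEq (powers_spowW (m * k) pg) h_pow) => //.
  by rewrite A6.2.
move=> {fallback} s7 [A7 f7 tr7]; have [c1' c2'] := consts_agree A7 isT isT cs.
apply: runs_seq; apply: runs_NSub; rewrite ?c1' //; first exact: fits1.
have f7' : fits (nreg s7 0 - 1 + 1) by have := fk 1; lia.
apply: runs_seq; apply: runs_NAdd; rewrite /= /upd /= ?c1'; [by apply: fitsW f7'; lia | exact: fits1 |].
set s8 := nset _ _ _.
have A8 : agree_off xs us s s8 by do 2![apply: agree_off_nset => //].
have E80 : nreg s8 0 = (nreg s7 0 - 1).+1 by rewrite /= addn1.
clearbody s8.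
apply: runs_seq; apply: runs_weaken (leqnn _) _.
  apply: (runs_power _ pg) => //; first exact: consts_agree A8 _ _ cs.
    by rewrite A8.2.
  by rewrite E80 -addn1.
rewrite E80 subn1 spow_predK => s9 [A89 E93].
have A9 : agree_off xs us s s9 by apply: (agree_off_trans A8 A89); apply/allP.
have A9' : agree_off [:: 0; 6; 7; 8; 9; 10; 11; 12; 15] us s s9.
  by apply: (agree_off_trans (agree_off_refl _ us s) A9) => //; apply/allP.
have E91 : sreg s9 1 = rep h by rewrite A9.2.
have E90 : nreg s9 0 = (nreg s7 0).-1.+1 by rewrite A89.1 // E80 subn1.
apply: (@runs_if _ _ _ _ _ _ 1).
  exact: (test_cost_SEq (powers_spowW (nreg s7 0) pg) h_pow).
rewrite /test_val E93 E91; case: ifPn => [/eqP/rep_inj Eh|/eqP Nh].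
  apply: runs_NConst => //.
  have suc : success (nset s9 12 1).
    by split=> //; rewrite /= /upd /= E90 // spow_predK.
  by split=> //; [exact: agree_off_nset | right].
apply: runs_NConst => //; split; first exact: agree_off_nset.
  by left; rewrite /= /upd /= A9.1 // E12.
by move=> /tr7 Eh; case: Nh; rewrite Eh.
Qed.

Definition reduction_cost K :=
  1 + (1 + (((K + 1) * K + K) * (1 + (4 + attempt_cost)) + 1)).

(** The loop ends at [(K0, j0)] at the latest, and earlier pairs involve no larger numbers, so
    bounds for [K0] serve for all rounds. *)
Lemma runs_reduction K0 j0 s : (forall x, nreg s x = 0) ->
  sreg s 0 = rep g -> sreg s 1 = rep h -> 0 < j0 <= K0 ->
  fits ((K0 * K0`! + 1) * K0`! + K0 + K0`! + 1) ->
  tractable (spow g (j0 * K0`! + 1)) K0`! ->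
  runs O W reduction s (reduction_cost K0)
    (fun s' => 0 < nreg s' 0 /\ spow g (nreg s' 0) = h).
Proof.
move=> n0 E0 E1 /andP[j0_gt0 le_j0] ftop tr.
have fk k : k <= (K0 * K0`! + 1) * K0`! + K0 + K0`! + 1 -> fits k.
  by move=> le_k; apply: fitsW ftop.
(* A lexicographic measure: incrementing [K] gains [K0 + 1], which outweighs the reset of [j] to 1.
   Until success, [Inv] keeps [(K, j)] lexicographically before [(K0, j0)]. *)
pose mu s' := (K0 + 1) * (K0 - nreg s' 3) + (K0 - nreg s' 4).
pose Inv s' := [/\ consts s', sreg s' 0 = rep g /\ sreg s' 1 = rep h,
  nreg s' 4 <= nreg s' 3 <= K0, nreg s' 5 = (nreg s' 3)`! &
  (nreg s' 12 = 0 /\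
    (nreg s' 3 < K0 \/ nreg s' 3 = K0 /\ nreg s' 4 < j0)) \/ success s'].
apply: runs_seq; apply: runs_NConst => //.
apply: runs_seq; apply: runs_NConst => //.
set s1 := nset _ _ _.
have -> : (K0 + 1) * K0 + K0 = mu s1 by rewrite /mu /s1 /= /upd /= !n0 !subn0.
apply: (@runs_while _ _ _ _ _ _ mu Inv).
- split; rewrite /s1 /= /upd /= ?n0 //; first by split; rewrite /= /upd /= ?n0.
  by left; split=> //; left; lia.
- by move=> s' [[c1' _] _ _ _ _]; apply: test_cost_NLt; rewrite c1' fits1.
- move=> s' [cs [E0' E1'] /andP[le_jK le_K] EF st]; have [c1 c2] := cs.
  rewrite /test_val c1 ltnS leqn0 => /eqP E12.
  have {st} lex : nreg s' 3 < K0 \/ nreg s' 3 = K0 /\ nreg s' 4 < j0.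
    by case: st => [[]//|[]]; rewrite E12.
  have le_F k : k <= K0 -> k`! <= K0`! by apply: leq_fact.
  have F_gt0 := fact_gt0 K0.
  have fK k : k <= K0 -> fits k by move=> le_k; apply: fk; lia.
  have fF k : k <= K0`! -> fits k by move=> le_k; apply: fk; lia.
  pose Adv s2 := [/\ agree_off [:: 3; 4; 5] [::] s' s2,
    0 < nreg s2 4 <= nreg s2 3, nreg s2 3 <= K0, nreg s2 5 = (nreg s2 3)`! &
    (nreg s2 3 < K0 \/ nreg s2 3 = K0 /\ nreg s2 4 <= j0) /\ mu s2 < mu s'].
  have adv : runs O W advance s' 4 Adv.
    apply: (@runs_if _ _ _ _ _ _ 3); first exact/test_cost_NLt/fK.
    rewrite /test_val; case: ifPn => [lt_jK|].
      apply: (@runs_leq _ _ _ _ 1) => //.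
      apply: runs_NAdd; rewrite ?c1; [by apply: fK; lia | exact: fits1 |].
      split; rewrite /= /upd /= ?EF //; try lia; first exact: agree_off_nset.
      split; first by case: lex; lia.
      by rewrite /mu /= /upd /=; lia.
    rewrite -leqNgt => le_Kj.
    have {lex} lt_K : nreg s' 3 < K0 by case: lex; lia.
    have E34 : nreg s' 4 = nreg s' 3 by lia.
    have leF := le_F _ le_K.
    apply: (@runs_seq _ _ _ _ _ 1 2).
    apply: runs_NAdd; rewrite ?c1; [exact: fK | exact: fits1 |].
    apply: (@runs_seq _ _ _ _ _ 1 1).
    apply: runs_NMul; rewrite /= /upd /= ?EF; [exact: fF | by apply: fK; lia |].
    apply: runs_NConst => //; split; rewrite /= /upd /= ?addn1 //.
    - by do 3![apply: agree_off_nset => //].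
    - by rewrite factS mulnC.
    split; first by lia.
    rewrite /mu /= /upd /= addn1 E34.
    have -> : K0 - nreg s' 3 = (K0 - (nreg s' 3).+1).+1 by lia.
    rewrite [X in _ < X + _]mulnS; lia.
  apply: (@runs_seq _ _ _ _ _ 4); apply: runs_weaken adv (leqnn _) _.
  move=> s2 [A2 /andP[j_gt0 le_jK2] le_K2 EF2 [lex2 lt_mu]].
  have cs2 := consts_agree A2 isT isT cs.
  have leF2 := le_F _ le_K2.
  apply: runs_weaken (leqnn _) _.
    apply: (@runs_attempt s2 (nreg s2 4) (nreg s2 3)`!) => //.
    - by rewrite A2.1.
    - by rewrite A2.2.
    - by rewrite A2.2.
    - exact: fact_gt0.
    apply: fk; rewrite leq_add2r !leq_add //; last by lia.
    rewrite leq_mul // leq_add2r leq_mul //; lia.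
  move=> s3 [A3 st tr3].
  have E33 : nreg s3 3 = nreg s2 3 by rewrite A3.1.
  have E34 : nreg s3 4 = nreg s2 4 by rewrite A3.1.
  split; last by move: lt_mu; rewrite /mu E33 E34.
  split; rewrite ?E33 ?E34 ?le_jK2 //.
  - exact: consts_agree A3 _ _ cs2.
  - by rewrite !A3.2 // !A2.2.
  - by rewrite A3.1.
  case: st => [E12'|suc]; last by right.
  case: lex2 => [lt_K|[EK le_jj0]]; first by left; split=> //; left.
  have [lt_j|] := ltnP (nreg s2 4) j0; first by left; split=> //; right.
  move=> ge_j; right; apply: tr3.
  have -> : nreg s2 4 = j0 by lia.
  by rewrite EK.
move=> s' [[c1 _] _ _ _ st] /=; rewrite c1 => N12.
by case: st => [[E12]|[]//]; rewrite E12 in N12.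
Qed.

End Correctness.
End Programs.

(** * Polynomial bounds on sizes and running time in terms of [K] *)

Section Bounds.
Local Open Scope nat_scope.

Lemma fact_leq_exp2 k : k`! <= 2 ^ (k * k).
Proof.
elim: k => // k IH; rewrite factS.
apply: (@leq_trans (2 ^ k.+1 * 2 ^ (k * k))); last first.
  by rewrite -expnD leq_exp2l //; nia.
by rewrite leq_mul // ltnW // ltn_expl.
Qed.

(** Both [K] and [K!] are at most [2 ^ (K * K)]; six such factors leave ample room for the largest
    number computed. *)
Definition size_bound K := 6 * (K * K).

Lemma reduction_fits K : 0 < K ->
  (K * K`! + 1) * K`! + K + K`! + 1 < 2 ^ size_bound K.
Proof.
move=> K_gt0; have F_gt0 := fact_gt0 K.
have le_F := fact_leq_exp2 K.
have lt_K : K < 2 ^ (K * K).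
  by apply: (leq_trans (ltn_expl K (isT : 1 < 2))); rewrite leq_exp2l // leq_pmulr.
set E := 2 ^ (K * K) in le_F lt_K.
have E2 : 2 <= E by lia.
have -> : 2 ^ size_bound K = E * E * E * (E * E * E).
  by rewrite /size_bound /E -!expnD; congr (_ ^ _); lia.
have le1 : K * K`! <= E * E by rewrite leq_mul // ltnW.
have le2 : K * K`! * K`! <= E * E * E by rewrite leq_mul.
have le3 : 8 <= E * E * E by nia.
have le4 : E <= E * E * E by nia.
nia.
Qed.

(** There are [O(K ^ 2)] attempts of [O(K ^ 4)] instructions, the latter from [O(K ^ 2)] bisection
    rounds with powerings of [O(K ^ 2)] steps; each instruction costs [O(K ^ 4)]. *)
Lemma reduction_cost_leq K : 0 < K ->
  reduction_cost (size_bound K) K * unit_cost K K (size_bound K)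
    <= 4000 * 54 * K ^ 10.
Proof.
move=> K_gt0.
have -> : K ^ 10 = K ^ 6 * K ^ 4 by rewrite -expnD.
have K2 : K * K = K ^ 2 by rewrite expnS expn1.
have K4 : K ^ 2 * K ^ 2 = K ^ 4 by rewrite -expnD.
have K24 : K ^ 2 * K ^ 4 = K ^ 6 by rewrite -expnD.
have p2 : K <= K ^ 2 by rewrite -K2 leq_pmulr.
have p4 : K ^ 2 <= K ^ 4 by rewrite leq_pexp2l.
have p6 : K ^ 4 <= K ^ 6 by rewrite leq_pexp2l.
have leU : unit_cost K K (size_bound K) <= 54 * K ^ 4.
  rewrite /unit_cost /size_bound K2; nia.
have leP : power_cost (size_bound K) <= 34 * K ^ 2.
  rewrite /power_cost /size_bound K2; lia.
have leB : bisect_cost (size_bound K) <= 471 * K ^ 4.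
  rewrite /bisect_cost; set X := 1 + (3 + _).
  have leX : size_bound K * X <= 6 * K ^ 2 * (78 * K ^ 2).
    by rewrite /size_bound K2 leq_mul // /X; lia.
  have : 6 * K ^ 2 * (78 * K ^ 2) = 468 * K ^ 4 by rewrite -K4; lia.
  by lia.
have leA : attempt_cost (size_bound K) <= 1064 * K ^ 4.
  rewrite /attempt_cost; lia.
have leR : reduction_cost (size_bound K) K <= 4000 * K ^ 6.
  have : (K + 1) * K + K <= 3 * K ^ 2 by rewrite -K2; nia.
  rewrite /reduction_cost => leK.
  have : ((K + 1) * K + K) * (1 + (4 + attempt_cost (size_bound K))) <=
         3 * K ^ 2 * (1069 * K ^ 4) by rewrite leq_mul //; lia.
  have -> : 3 * K ^ 2 * (1069 * K ^ 4) = 3207 * K ^ 6 by rewrite -K24; lia.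
  by lia.
have -> : 4000 * 54 * (K ^ 6 * K ^ 4) = (4000 * K ^ 6) * (54 * K ^ 4) by lia.
exact: leq_mul.
Qed.

End Bounds.

(** * Generators of the group make every power of [g] tractable *)

Section Tractable.
Local Open Scope nat_scope.
Variables (S : semigroupType) (rep : S -> bitseq) (O : oracles) (g : S).
Variables (l n F m : nat).
Hypothesis minln : minimal_index_period g l n.
Hypothesis le_lF : l <= F.
Hypothesis m_gen : generates (spow g m) (periodic_part g l n).
Hypothesis oracleP : forall hist u, periodic_part g l n u ->
  let k := dlog O hist (rep (spow g m)) (rep u) in
  [/\ 0 < k, k < F & u = spow (spow g m) k].

Lemma solved_spow i : 0 < i -> l <= i -> solved rep O (spow g m) (spow g i) F.
Proof.
move=> i_gt0 le_li hist.
have [|? ? E] := oracleP hist (u := spow g i); last by split.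
by rewrite periodic_part_spow.
Qed.

(** The product [g ^ (i + c)] lies in the group exactly when [l <= i + c]; outside it cannot be a
    power of [g ^ m], whose powers form the group. *)
Lemma threshold_spow i : 0 < i -> i < l ->
  threshold rep O g (spow g m) (spow g i) F (l - i - 1).
Proof.
move=> i_gt0 lt_il; split; first lia.
move=> c c_gt0; rewrite -spowD //; split=> [lt_c|le_c k E].
  by apply: solved_spow; lia.
have : powers (spow g m) (spow g (i + c)) by rewrite -E; exact: powers_spow.
by rewrite m_gen periodic_part_spow //; lia.
Qed.

Lemma tractable_powers h : powers g h -> tractable rep O g h (spow g m) F.
Proof.
move=> [x x_gt0 ->]; have [le_lx|lt_xl] := leqP l x.
  by left; apply: solved_spow.
(* Here [l >= 2], so no subtraction is truncated and [(l - 2) + 1 - (l - x - 1) = x]. *)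
right; exists (l - 1 - 1), (l - x - 1); split.
- by apply: (@threshold_spow 1) => //; lia.
- exact: threshold_spow.
- by congr spow; lia.
Qed.

End Tractable.

(** * Sizes and orders in terms of [kappa] *)

Section Kappa.
Variables (R : realType) (S : semigroupType) (rep : S -> bitseq) (g : S).
Hypothesis S_per : periodic S.

Lemma sorder_gt0 : (0 < sorder g)%N.
Proof.
by rewrite cardfs_gt0; apply/fset0Pn; exists g; rewrite in_fset_set // inE; exists 1%N.
Qed.

Lemma ln_sorder_ge0 : 0 <= ln (sorder g)%:R / ln 2 :> R.
Proof. by rewrite divr_ge0 // ln_ge0 // ler1n ?sorder_gt0. Qed.

Lemma kappa_ge0 : 0 <= kappa R rep g.
Proof. by rewrite addr_ge0 ?ler0n ?ln_sorder_ge0. Qed.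

Lemma size_leq_kappa a : powers g a -> (size (rep a))%:R <= kappa R rep g.
Proof.
move=> pa; rewrite /kappa -[leLHS]addr0 lerD ?ln_sorder_ge0 // ler_nat.
 apply: (leq_bigmax_seq (F := fun a => size (rep a))) => //.
by rewrite in_fset_set // inE.
Qed.

Lemma sorder_lt_exp2 k : kappa R rep g < k%:R -> (sorder g < 2 ^ k)%N.
Proof.
move=> lt_k.
have ln2 : 0 < ln 2 :> R by rewrite ln_gt0 // ltr1n.
have : ln (sorder g)%:R / ln 2 < k%:R :> R.
  by apply: le_lt_trans lt_k; rewrite lerDr.
rewrite ltr_pdivrMr // mulr_natl -lnXn ?ltr0n // ltr_ln ?posrE ?exprn_gt0 ?ltr0n ?sorder_gt0 //.
by rewrite -natrX ltr_nat.
Qed.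

End Kappa.

(** * Assembly of the reduction theorem *)

Lemma Pr_always (R : realType) T (E : T.-tuple bool -> Prop) :
  (forall cs, E cs) -> Pr R E = 1.
Proof.
move=> allE; rewrite /Pr (eq_card (B := {: T.-tuple bool})).
  by rewrite card_tuple card_bool natrX divff // expf_neq0 // pnatr_eq0.
by move=> cs; rewrite !inE; apply/asboolP.
Qed.

(** Squares keep the summands nonnegative, so [K] dominates [kappa] and both polynomial values
    separately, whatever the signs of [po] and [pm]. *)
Lemma reduction_correct (R : realType) (S : semigroupType)
    (rep : S -> bitseq) (O : oracles) (g h : S) (l n K : nat) (pm po : {poly R}) :
  periodic S -> injective rep -> minimal_index_period g l n -> powers g h ->
  multiplies rep g pm O -> DLP_oracle rep g (periodic_part g l n) po O ->
  kappa R rep g + po.[kappa R rep g] ^+ 2 + pm.[kappa R rep g] ^+ 2 + 3 <= K%:R ->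
  forall cs, exists k t, [/\ outputs O reduction (rep g) (rep h) cs k t,
    (t <= 4000 * 54 * K ^ 10)%N, (0 < k)%N & spow g k = h].
Proof.
move=> S_per rep_inj minln h_pow mulP oracleP; set x := kappa R rep g => le_xK cs.
have x_ge0 : 0 <= x by exact: kappa_ge0.
have le_sq (y : R) : y <= y ^+ 2 + 1.
  rewrite -subr_ge0; have -> : y ^+ 2 + 1 - y = (y - 2^-1) ^+ 2 + 3 / 4.
    by field.
  by rewrite addr_ge0 ?sqr_ge0 ?divr_ge0.
have po2 : 0 <= po.[x] ^+ 2 := sqr_ge0 _.
have pm2 : 0 <= pm.[x] ^+ 2 := sqr_ge0 _.
have K_gt0 : (0 < K)%N by rewrite -(ltr0n R); lra.
have lt_sK : (sorder g < 2 ^ K.-1)%N.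
  apply: (@sorder_lt_exp2 R _ rep) => //; rewrite -/x -(ltrD2r 1).
  by rewrite natr1 prednK //; lra.
have le_ln := leq_sorder minln S_per.
have [l_gt0 n_gt0 _ _] := minln.
(* This turns the bounds on the order of [g] and on the bit size of legal answers into bounds by
   [K!], for the index and for the cap in [ask]. *)
have le_EF : (2 ^ K.-1 <= K`!)%N by rewrite -{2}(prednK K_gt0) leq_exp2_fact.
have le_lF : (l <= K`!)%N by lia.
have lt_nK : (n < 2 ^ K)%N.
  apply: (@leq_ltn_trans (sorder g)); first lia.
  by apply: leq_trans lt_sK _; rewrite leq_exp2l ?leq_pred.
have [j j_itv co_j] := exists_coprime_beta n_gt0 lt_nK.
rewrite add1n -addn1 in co_j.
have le_lm : (l <= j * K`! + 1)%N.
  by case/andP: j_itv => j_gt0 _; rewrite (leq_trans le_lF) // -[X in (X <= _)%N]mul1n; nia.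
have m_gen := generates_spow minln le_lm co_j.
have tr : tractable rep O g h (spow g (j * K`! + 1)) K`!.
  apply: (tractable_powers minln le_lF m_gen) => // hist u Gu.
  have [||k_gt0 Eu le_k] := oracleP hist (spow g (j * K`! + 1)) u => //.
    by rewrite m_gen.
  split=> //; apply: leq_trans le_EF.
  apply: (leq_trans (up_logP _ (isT : (1 < 2)%N))).
  rewrite leq_exp2l // -(ler_nat R) (le_trans le_k) // -/x -(lerD2r 1).
  rewrite natr1 prednK //; have := le_sq po.[x]; lra.
have sizeP a : powers g a -> (size (rep a) <= K)%N.
  move=> /(size_leq_kappa R rep S_per) le_s; rewrite -(ler_nat R) (le_trans le_s) //.
  by rewrite -/x; lra.
have costP a b : powers g a -> powers g b -> (mulcost O (rep a) (rep b) <= K)%N.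
  move=> pa pb; have [_ le_c] := mulP a b pa pb; rewrite -(ler_nat R) (le_trans le_c) //.
  by rewrite -/x; have := le_sq pm.[x]; lra.
have mulE a b : powers g a -> powers g b ->
    Defs.mul O (rep a) (rep b) = rep (a * b)%g.
  by move=> pa pb; case: (mulP a b pa pb).
have bl_gt0 : (0 < size_bound K)%N by rewrite /size_bound !muln_gt0 K_gt0.
have [s [t [e le_t [k_gt0 Ek]]]] := runs_reduction rep_inj h_pow mulE costP sizeP bl_gt0
  (s := init (rep g) (rep h) cs) (fun=> erefl) erefl erefl j_itv (reduction_fits K_gt0) tr.
exists (nreg s 0), t; split=> //; first by exists s.
exact: (leq_trans le_t (reduction_cost_leq K_gt0)).
Qed.

(* A run within time T flips at most T coins, so the probability below is the
   same for every T bounding the running time.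

   The last clause bounds all runs; it needs the oracle's answers to illegal
   inputs to be bounded too, since kappa is not known to the program. *)
Theorem mainTheorem1 (R : realType) :
  (forall (S : semigroupType) (g : S) (l n : nat),
     periodic S -> minimal_index_period g l n ->
     cyclic_subgroup (periodic_part g l n)) /\
  exists P : cmd, forall pm po : {poly R}, exists q : {poly R},
    forall (S : semigroupType) (rep : S -> bitseq) (O : oracles)
           (g h : S) (l n : nat),
      periodic S ->
      injective rep ->
      minimal_index_period g l n ->
      powers g h ->
      multiplies rep g pm O ->
      DLP_oracle rep g (periodic_part g l n) po O ->
      forall T : nat, q.[kappa R rep g] <= T%:R ->
        2 / 3 <= Pr R (fun cs : T.-tuple bool =>
          exists k t, [/\ outputs O P (rep g) (rep h) cs k t,
            t%:R <= q.[kappa R rep g], (0 < k)%N & spow g k = h])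
        /\
        ((forall hist u v,
            (bitlen (dlog O hist u v))%:R <= po.[kappa R rep g]) ->
         forall cs : T.-tuple bool,
           exists k t, outputs O P (rep g) (rep h) cs k t /\
             t%:R <= q.[kappa R rep g]).
Proof.
split=> [S g l n _ minln|]; first exact: periodic_part_cyclic minln.
exists reduction => pm po.
(* The constant exceeds the 3 required of [K] by one, to make up for truncating [z] to an
   integer. *)
pose z : {poly R} := 'X + po ^+ 2 + pm ^+ 2 + 4%:P.
exists ((4000 * 54)%:R *: z ^+ 10) => S rep O g h l n S_per rep_inj minln h_pow mulP oracleP.
set x := kappa R rep g; set q := _.[x].
have Ez : z.[x] = x + po.[x] ^+ 2 + pm.[x] ^+ 2 + 4 by rewrite !hornerE.
have z_ge0 : 0 <= z.[x].
  have x_ge0 : 0 <= x by apply: kappa_ge0.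
  by have := sqr_ge0 po.[x]; have := sqr_ge0 pm.[x]; rewrite Ez; lra.
have /andP[le_Kz lt_zK] := truncn_itv z_ge0.
have le_K : x + po.[x] ^+ 2 + pm.[x] ^+ 2 + 3 <= (Num.trunc z.[x])%:R.
  by rewrite -natr1 {1}Ez in lt_zK; lra.
have run := reduction_correct S_per rep_inj minln h_pow mulP oracleP le_K.
have costP t : (t <= 4000 * 54 * Num.trunc z.[x] ^ 10)%N -> t%:R <= q.
  rewrite -(ler_nat R) => le_t; rewrite (le_trans le_t) //.
  rewrite natrM natrX /q hornerZ horner_exp ler_wpM2l ?ler0n //.
  by rewrite lerXn2r // nnegrE ler0n.
move=> T _; split=> [|_ cs].
  rewrite Pr_always => [|cs]; first by lra.
  by have [k [t [out /costP le_t k_gt0 Ek]]] := run cs; exists k, t.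
by have [k [t [out /costP le_t _ _]]] := run cs; exists k, t.
Qed.
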